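(* Let $\mathfrak{h}\in\mathbb{H}_d$ be a doubling dimension function and let $E\subseteq\mathbb{R}^2$ be an $F_{\mathfrak{h}}$-set. Let $h\in\mathbb{H}$ be a dimension function such that $h\prec \mathfrak{h}^2$. If $$\sum_{k} \mathfrak{h}(2^{-k})\sqrt{\frac{k}{h(2^{-k})}}<\infty,$$ where the sum runs over $k\in\mathbb{N}$, then $\mathcal{H}^{h}(E)>0$.
   Context: Dimension functions: $\mathbb{H}$ is the set of functions $h:[0,\infty)\to[0,\infty)$ that are non-decreasing, right continuous, and satisfy $h(0)=0$. The subclass $\mathbb{H}_d\subseteq\mathbb{H}$ consists of those $h\in\mathbb{H}$ for which there is a constant $C>0$ with $h(2x)\le C\,h(x)$ for all $x$. Hausdorff measures: for $h\in\mathbb{H}$, $E\subseteq\mathbb{R}^2$ and $\delta>0$, $\mathcal{H}^h_\delta(E)=\inf\{\sum_i h(\operatorname{diam}(E_i)) : E\subseteq\bigcup_{i=1}^\infty E_i,\ \operatorname{diam}(E_i)<\delta\}$, and $\mathcal{H}^h(E)=\sup_{\delta>0}\mathcal{H}^h_\delta(E)$ (an outer measure). Order: for dimension functions $g,h$, $g\prec h$ means $\lim_{x\to0^+} h(x)/g(x)=0$ (in particular $g(x)>0$ for $x>0$). $\mathfrak{h}^2$ denotes the function $x\mapsto \mathfrak{h}(x)^2$. Furstenberg sets: for $\mathfrak{h}\in\mathbb{H}$, a set $E\subseteq\mathbb{R}^2$ is an $F_{\mathfrak{h}}$-set (Furstenberg set of type $\mathfrak{h}$) if for each direction $e$ in the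 unit circle $\mathbb{S}$ there is a line segment $\ell_e$ in the direction of $e$ such that $\mathcal{H}^{\mathfrak{h}}(\ell_e\cap E)>0$. *)

(* Defs.v *)
From HB Require Import structures.
From mathcomp Require Import all_boot all_order all_algebra.
From mathcomp Require Import all_classical all_reals all_analysis.

Set Implicit Arguments.
Unset Strict Implicit.
Unset Printing Implicit Defensive.

Import Order.TTheory GRing.Theory Num.Theory.
Import numFieldNormedType.Exports.

Local Open Scope classical_set_scope.
Local Open Scope ring_scope.

(* The library norm on R * R is the sup norm, so the Euclidean norm is defined
   by hand. *)
Definition enorm2 (R : realType) (x : R * R) : R :=
  Num.sqrt (x.1 ^+ 2 + x.2 ^+ 2).

(* The maximum with 0 only matters for the empty set, whose supremum of
   distances would otherwise be -oo. *)
Definition ediam (R : realType) (A : set (R * R)) : \bar R :=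
  maxe 0%E (ereal_sup [set (enorm2 (p.1 - p.2))%:E | p in A `*` A]).

(* A function [0, +oo[ -> [0, +oo[ is encoded as a function R -> R whose values
   at negative reals are unconstrained and never used. *)
Definition dimension_function (R : realType) (h : R -> R) : Prop :=
  [/\ forall x, 0 <= x -> 0 <= h x,
      forall x y, 0 <= x -> x <= y -> h x <= h y,
      forall x, 0 <= x -> h y @[y --> x^'+] --> h x
    & h 0 = 0].

Definition doubling_dimension_function (R : realType) (h : R -> R) : Prop :=
  dimension_function h /\
  exists2 C : R, 0 < C & forall x, 0 <= x -> h (2 * x) <= C * h x.

(* Positivity of g is stated separately because division by zero yields 0. *)
Definition dim_prec (R : realType) (g h : R -> R) : Prop :=
  (forall x, 0 < x -> 0 < g x) /\ h x / g x @[x --> 0^'+] --> (0 : R).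

(* In an admissible cover every diameter is finite, so `fine` loses nothing. *)
Definition hausdorff_delta (R : realType) (h : R -> R) (delta : R)
    (A : set (R * R)) : \bar R :=
  ereal_inf [set (\sum_(0 <= i <oo) (h (fine (ediam (F i))))%:E)%E |
    F in [set F : (set (R * R))^nat |
      A `<=` \bigcup_i F i /\ forall i, (ediam (F i) < delta%:E)%E]].

Definition hausdorff (R : realType) (h : R -> R) (A : set (R * R)) : \bar R :=
  ereal_sup [set hausdorff_delta h delta A | delta in [set d : R | 0 < d]].

Definition unit_circle (R : realType) : set (R * R) :=
  [set e | enorm2 e = 1].

Definition segment_in_direction (R : realType) (e : R * R)
    (l : set (R * R)) : Prop :=
  exists (a : R * R) (L : R), 0 < L /\ l = [set a + t *: e | t in `[0, L]].

Definition furstenberg_set (R : realType) (h : R -> R)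
    (E : set (R * R)) : Prop :=
  forall e, unit_circle e ->
    exists2 l, segment_in_direction e l & (0 < hausdorff h (l `&` E))%E.

(* Main.v *)
Require Import Defs.
From HB Require Import structures.
From mathcomp Require Import all_boot all_order all_algebra.
From mathcomp Require Import all_classical all_reals all_analysis.
From mathcomp Require Import zify ring lra.
Import Order.TTheory GRing.Theory Num.Theory.
Import numFieldNormedType.Exports.

(** Write w for 2 ^+ k.  Suppose that H^h(E) = 0, so that E has covers by sets
    F_i of diameters d_i with \sum_i h(d_i) as small as desired.  Only the
    directions with slope t in [0, 1[ are used, and it is shown that the set of
    these slopes would be Lebesgue-null.

    Countably many classes of slopes suffice: those t for which some segment of
    slope t and bounded length meets E in a set of hh-content, at a fixed scale,
    above a fixed threshold (furstenberg_rich_slopes).  Fix such a class, take a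
    cover as above, and group the F_i by the level k with
    2^-k <= d_i < 2 * 2^-k.  Let Q_k be the collection of dyadic cells of side
    2^-k near the F_i of level k; it has at most 25 cells for each such i
    (ex_cells_near_level).  If a segment met fewer than
    c * sqrt(k / h(2^-k)) cells of Q_k for every k >= 1, then covering its
    intersection with E by these cells would make its hh-content at most a
    multiple of c * \sum_k hh(2^-k) sqrt(k / h(2^-k)), thanks to the doubling
    property (hausdorff_delta_le_cells).  The series converges, so for small c
    this contradicts the lower bound on the content.  Hence every slope of the
    class has a segment that meets at least M_k = c * sqrt(k / h(2^-k)) cells
    of Q_k, for some k >= 1.

    For a single k such slopes are rare, by a discrete form of Cordoba's L2
    bound for the Kakeya maximal function.  Let N of the w dyadic intervals of
    slopes contain such a slope, and pick one segment for each.  Segments with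
    slopes in the j-th and j'-th interval share at most C * w / (1 + |j - j'|)
    cells (common_cells_le), and the sum of these bounds over j' is harmonic,
    of order w * k.  By Cauchy-Schwarz on incidences (incidence_sqr_le),
    (N * M_k)^2 <= |Q_k| * N * C * w * k, that is
    N / w <= C * |Q_k| * k / M_k^2 <= C' * |Q_k| * h(2^-k).  The right-hand side
    is at most a multiple of the sum of the h(d_i) of level k because h is
    non-decreasing.  Summing over k, the whole class of slopes has measure at
    most a multiple of \sum_i h(d_i), which is arbitrarily small. *)

Set Implicit Arguments.
Unset Strict Implicit.
Unset Printing Implicit Defensive.

Local Open Scope classical_set_scope.
Local Open Scope ring_scope.

(** * Cauchy-Schwarz for incidences *)

Lemma sqr_sum_le (R : realFieldType) (T : Type) (s : seq T) (f : T -> R) :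
  (\sum_(q <- s) f q) ^+ 2 <= (size s)%:R * \sum_(q <- s) f q ^+ 2.
Proof.
case: (posnP (size s)) => [/size0nil ->|s_gt0]; first by
  rewrite !big_nil expr0n mulr0.
set S := \sum_(q <- s) f q; set n := (size s)%:R : R.
have n_gt0 : 0 < n by rewrite ltr0n.
(* The variance of f is nonnegative; multiplying by n clears denominators. *)
have : 0 <= \sum_(q <- s) (n * f q - S) ^+ 2 by apply: sumr_ge0 => q _; exact: sqr_ge0.
have -> : \sum_(q <- s) (n * f q - S) ^+ 2
    = n * (n * \sum_(q <- s) f q ^+ 2 - S ^+ 2).
  transitivity (\sum_(q <- s) (n ^+ 2 * f q ^+ 2 - (2 * n * S) * f q + S ^+ 2)).
    by apply: eq_bigr => q _; ring.
  rewrite big_split sumrB /= -!mulr_sumr big_const_seq count_predT iter_addr_0.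
  by rewrite -/S -[_ *+ size s]mulr_natl -/n; ring.
by rewrite pmulr_rge0// subr_ge0.
Qed.

(** Count the incidences by their second argument and apply Cauchy-Schwarz: the
    square of the number of i in P incident to q counts the pairs of elements
    of P that share q, so few shared elements force few incidences. *)
Lemma incidence_sqr_le (R : realFieldType) (I : finType) (T : Type)
    (P : {set I}) (Q : seq T) (inc : I -> T -> bool) (M : R) (B : I -> I -> R) :
    0 <= M ->
    (forall i, i \in P -> M <= (count (inc i) Q)%:R) ->
    (forall i j, i \in P -> j \in P ->
      (count (fun q => inc i q && inc j q) Q)%:R <= B i j) ->
  (#|P|%:R * M) ^+ 2
    <= (size Q)%:R * \sum_(i in P) \sum_(j in P) B i j.
Proof.
move=> M_ge0 richP commonP.
have countE (p : T -> bool) : (count p Q)%:R = \sum_(q <- Q) (p q)%:R :> R.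
  by rewrite -sum1_count big_mkcond/= natr_sum; apply: eq_bigr => q _; case: (p q).
pose deg q : R := \sum_(i in P) (inc i q)%:R.
have le_deg : #|P|%:R * M <= \sum_(q <- Q) deg q.
  rewrite exchange_big /= mulr_natl -sumr_const.
  by apply: ler_sum => i iP; rewrite -countE; exact: richP.
apply: (@le_trans _ _ ((\sum_(q <- Q) deg q) ^+ 2)).
  by rewrite ler_sqr// nnegrE ?mulr_ge0//; apply: le_trans le_deg; rewrite mulr_ge0.
apply: (le_trans (sqr_sum_le _ _)); rewrite ler_wpM2l//.
have -> : \sum_(q <- Q) deg q ^+ 2
    = \sum_(i in P) \sum_(j in P) \sum_(q <- Q) (inc i q && inc j q)%:R.
  under eq_bigr => q _.
    rewrite expr2 big_distrl /=.
    under eq_bigr => i _ do rewrite big_distrr /=.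
    over.
  rewrite exchange_big; apply: eq_bigr => i _; rewrite exchange_big.
  by apply: eq_bigr => j _; apply: eq_bigr => q _; rewrite -natrM mulnb.
apply: ler_sum => i iP; apply: ler_sum => j jP.
by rewrite -countE; exact: commonP.
Qed.

(** Each dyadic block of the harmonic series contributes at most 1. *)
Lemma harmonic_le (R : realFieldType) k :
  \sum_(0 <= m < 2 ^ k) (m.+1%:R)^-1 <= (k.+1)%:R :> R.
Proof.
elim: k => [|k IHk]; first by rewrite expn0 big_nat1 invr1.
rewrite (big_cat_nat (n := (2 ^ k)%N))//=; last by rewrite leq_exp2l.
rewrite -[(k.+2)%:R]natr1 lerD//.
apply: (@le_trans _ _ (\sum_(2 ^ k <= m < 2 ^ k.+1) ((2 ^ k)%:R : R)^-1)).
  apply: ler_sum_nat => m /andP[km _].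
  by rewrite lef_pV2 ?posrE ?ltr0n ?expn_gt0// ler_nat ltnW.
by rewrite sumr_const_nat expnS mul2n -addnn addnK -[_ *+ _]mulr_natr mulVf//.
Qed.

(** This is the logarithmic loss in the maximal estimate.  The distance of i and
    j is the sum of two truncated differences, one of which vanishes. *)
Lemma sum_inv_dist_le (R : realFieldType) k (i : nat) : (i < 2 ^ k)%N ->
  \sum_(j < 2 ^ k) ((1 + ((i - j) + (j - i)))%N%:R)^-1 <= 2 * (k.+1)%:R :> R.
Proof.
move=> ik; pose f m : R := (m.+1%:R)^-1.
have f_ge0 m : 0 <= f m by rewrite invr_ge0.
have part m : (m <= 2 ^ k)%N -> \sum_(0 <= j < m) f j <= (k.+1)%:R.
  move=> mk; apply: le_trans (harmonic_le R k).
  by rewrite [leRHS](big_cat_nat (n := m))//= lerDl sumr_ge0.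
rewrite -(big_mkord xpredT (fun j => ((1 + ((i - j) + (j - i)))%N%:R : R)^-1)).
rewrite (big_cat_nat (n := i.+1))//= mulr2n mulrDl !mul1r lerD//.
  rewrite big_nat_rev /= (@eq_big_nat _ _ _ _ _ _ f) ?part//.
  by move=> j /andP[_ ji]; rewrite /f; congr (_%:R^-1); lia.
rewrite -{1}[i.+1]add0n big_addn (@eq_big_nat _ _ _ _ _ _ (fun j => f j.+1)).
  apply: (le_trans _ (part (2 ^ k - i.+1).+1 _)); last by lia.
  by rewrite big_nat_recl// lerDr.
by move=> j _; rewrite /f; congr (_%:R^-1); lia.
Qed.

(** * Dyadic cells met by segments of slope between 0 and 1 *)

Section Cells.
Context {R : realType}.
Implicit Types (k : nat) (a b t L : R) (p : R * R) (c : int * int).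

Definition cell k p : int * int :=
  (Num.floor (2 ^+ k * p.1), Num.floor (2 ^+ k * p.2)).

(** Segments are parametrised by abscissa, so L bounds the length of the
    projection to the first axis rather than the length itself. *)
Definition slanted_segment a b t L : set (R * R) :=
  [set p | a <= p.1 <= a + L /\ p.2 = b + t * p.1].

Definition meets_cell k (A : set (R * R)) c : bool :=
  `[< exists2 p, A p & cell k p = c >].

Lemma size_int_le (s : seq int) (u v : R) : uniq s -> u <= v ->
  {in s, forall z, u <= z%:~R <= v} -> (size s)%:R <= v - u + 1.
Proof.
case: s => [|z0 s'] s_uniq uv s_uv; first by rewrite /= addr_ge0// subr_ge0.
set s := z0 :: s' in s_uniq s_uv *.
pose p := Num.ceil u; pose q := Num.floor v.
have pq z : z \in s -> p <= z <= q.
  by move=> /s_uv/andP[uz zv]; rewrite ceil_le_int floor_ge_int uz zv.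
have pq0 : p <= q by have /andP[] := pq z0 (mem_head _ _); exact: le_trans.
pose n := absz (q - p + 1).
have : (size s <= size [seq (p + i%:Z)%R | i : nat <- iota 0 n])%N.
  apply: uniq_leq_size => // z /pq zpq; apply/mapP.
  by exists (absz (z - p)); rewrite ?mem_iota; lia.
rewrite size_map size_iota -(ler_nat R) /n => /le_trans; apply.
rewrite pmulrn gez0_abs; last by lia.
rewrite intrD intrB lerD2r lerB// ?ceil_ge//; exact: floor_le_tmp.
Qed.

(** When each column contains at most two of the cells, their number is at most
    twice the number of columns. *)
Lemma size_columns_le (F : int -> int) (s : seq (int * int)) (u v : R) :
    uniq s -> u <= v ->
    {in s, forall c, u <= c.1%:~R <= v} ->
    {in s, forall c, (c.2 == F c.1) || (c.2 == F c.1 + 1)} ->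
  (size s)%:R <= 2 * (v - u + 1).
Proof.
move=> s_uniq uv s_uv s_F; pose low c := c.2 == F c.1.
have part (P : pred (int * int)) :
    {in [seq c <- s | P c] &, injective fst} ->
  (size [seq c <- s | P c])%:R <= v - u + 1.
  move=> Pinj; rewrite -(size_map fst); apply: size_int_le => //.
    by rewrite map_inj_in_uniq// filter_uniq.
  by move=> _ /mapP[c + ->]; rewrite mem_filter => /andP[_ /s_uv].
rewrite -(count_predC low s) natrD mulr2n mulrDl mul1r -!size_filter.
apply: lerD; apply: part => -[x y] [x' y']; rewrite !mem_filter /low /=.
  by move=> /andP[/eqP-> _] /andP[/eqP-> _] ->.
move=> /andP[/negbTE lo /s_F] /=; rewrite lo /= => /eqP ->.
by move=> /andP[/negbTE lo' /s_F] /=; rewrite lo' /= => /eqP -> ->.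
Qed.

(** A line of slope at most 1 rises by at most one cell across a column, so in
    each column it meets at most the cell f where it enters and the one above. *)
Lemma cell_on_line k a b t L c : 0 <= t <= 1 ->
    meets_cell k (slanted_segment a b t L) c ->
  [/\ 2 ^+ k * a - 1 <= c.1%:~R <= 2 ^+ k * (a + L),
      2 ^+ k * b + t * c.1%:~R - 1 <= c.2%:~R <= 2 ^+ k * b + t * c.1%:~R + 1
    & let f := Num.floor (2 ^+ k * b + t * c.1%:~R) in
      (c.2 == f) || (c.2 == f + 1)].
Proof.
move=> /andP[t0 t1] /asboolP[[x y] [/= /andP[ax xa] ->] <- /=].
set w : R := 2 ^+ k; have w_gt0 : 0 < w by exact: exprn_gt0.
have wax : w * a <= w * x by rewrite ler_wpM2l// ltW.
have wxa : w * x <= w * (a + L) by rewrite ler_wpM2l// ltW.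
have /andP[] := floor_itv (w * x); set X := Num.floor _ => X1 X2.
have /andP[] := floor_itv (w * (b + t * x)); set Y := Num.floor _ => Y1 Y2.
rewrite !intrD in X2 Y2.
have E : w * (b + t * x) = w * b + t * (w * x) by ring.
rewrite E in Y1 Y2.
have tX1 : t * X%:~R <= t * (w * x) by rewrite ler_wpM2l.
have tX2 : t * (w * x) <= t * X%:~R + 1.
  by rewrite (le_trans (ler_wpM2l t0 (ltW X2)))// mulrDr mulr1 lerD2l.
split; [by apply/andP; split; lra|by apply/andP; split; lra|].
have /andP[] := floor_itv (w * b + t * X%:~R); set f := Num.floor _ => f1 f2.
rewrite intrD in f2.
have fY : f < Y + 1 by rewrite -(ltr_int R) intrD; lra.
have Yf : Y < f + 2 by rewrite -(ltr_int R) intrD; lra.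
by move: fY Yf; clearbody f Y; clear; lia.
Qed.

Lemma common_cells_le_length k a b t L (s : seq (int * int)) :
    0 <= t <= 1 -> 0 <= L -> uniq s ->
    {in s, forall c, meets_cell k (slanted_segment a b t L) c} ->
  (size s)%:R <= 2 * (2 ^+ k * L + 2).
Proof.
move=> t01 L0 s_uniq s_l.
have w_gt0 : 0 < 2 ^+ k :> R by exact: exprn_gt0.
have -> : 2 ^+ k * L + 2 = 2 ^+ k * (a + L) - (2 ^+ k * a - 1) + 1 by ring.
apply: (@size_columns_le (fun z => Num.floor (2 ^+ k * b + t * z%:~R))) => //.
- by rewrite mulrDr; have := mulr_ge0 (ltW w_gt0) L0; lra.
- by move=> c /s_l /(cell_on_line t01)[].
- by move=> c /s_l /(cell_on_line t01)[].
Qed.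

(** Two lines at vertical distance below two cells over a column of abscissa z
    satisfy |w * (b - b') + (t - t') * z| < 2, which confines z to an interval
    of length 4 / |t - t'|. *)
Lemma common_cells_le_angle k a b t a' b' t' L (s : seq (int * int)) :
    0 <= t <= 1 -> 0 <= t' <= 1 -> t != t' -> uniq s ->
    {in s, forall c, meets_cell k (slanted_segment a b t L) c} ->
    {in s, forall c, meets_cell k (slanted_segment a' b' t' L) c} ->
  (size s)%:R <= 2 * (4 / `|t - t'| + 1).
Proof.
move=> t01 t01' tt' s_uniq s_l s_l'.
set e := `|t - t'|; have e_gt0 : 0 < e by rewrite normr_gt0 subr_eq0.
pose w : R := 2 ^+ k; pose x := w * (b' - b) / (t - t').
have -> : 4 / e + 1 = (x + 2 / e) - (x - 2 / e) + 1 by ring.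
apply: (@size_columns_le (fun z => Num.floor (2 ^+ k * b + t * z%:~R))) => //.
- by have : 0 < 2 / e by [exact: divr_gt0]; lra.
- move=> c cs.
  have [_ /andP[c1 c2] _] := cell_on_line t01 (s_l c cs).
  have [_ /andP[c1' c2'] _] := cell_on_line t01' (s_l' c cs).
  rewrite -ler_distl -(ler_pM2r e_gt0) divfK ?gt_eqF// -normrM.
  rewrite mulrBl divfK ?subr_eq0// ler_norml.
  by rewrite -/w in c1 c2 c1' c2'; apply/andP; split; lra.
- by move=> c /s_l /(cell_on_line t01)[].
Qed.

(** The angle bound is useful only for intervals of slopes that are not adjacent,
    because then |t - t'| is comparable to the distance of j and j' divided by
    2^k; for equal or adjacent intervals the bound by the length is of the
    right order already. *)
Lemma common_cells_le k (j j' : nat) a b t a' b' t' L (s : seq (int * int)) :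
    (j < 2 ^ k)%N -> (j' < 2 ^ k)%N -> 1 <= L ->
    0 <= t <= 1 -> 0 <= t' <= 1 ->
    j%:R <= 2 ^+ k * t <= j.+1%:R -> j'%:R <= 2 ^+ k * t' <= j'.+1%:R ->
    uniq s ->
    {in s, forall c, meets_cell k (slanted_segment a b t L) c} ->
    {in s, forall c, meets_cell k (slanted_segment a' b' t' L) c} ->
  (size s)%:R <= 26 * L * 2 ^+ k * ((1 + ((j - j') + (j' - j)))%N%:R)^-1.
Proof.
move=> jk jk' L1 t01 t01' tj tj' s_uniq s_l s_l'.
set w : R := 2 ^+ k; have w_ge1 : 1 <= w by rewrite exprn_ege1// ler1n.
set d := (j - j' + (j' - j))%N; pose D : R := d%:R.
have dD : (1 + d)%:R = 1 + D by rewrite natrD.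
have D_gt0 : 0 < 1 + D by rewrite -dD ltr0n.
have Dw : 1 + D <= w.
  by rewrite -dD /w -natrX ler_nat /d; move: jk jk'; clear; lia.
rewrite dD ler_pdivlMr//.
have [d1|d2] := leqP d 1.
  have D1 : D <= 1 by rewrite /D lern1.
  have := common_cells_le_length t01 (le_trans ler01 L1) s_uniq s_l.
  have D0 : 0 <= D by rewrite ler0n.
  have sz0 : 0 <= (size s)%:R :> R by rewrite ler0n.
  rewrite -/w; nra.
have tt'w : (D + 1) / 3 <= w * `|t - t'|.
  have -> : w * `|t - t'| = `|w * t - w * t'|.
    by rewrite -mulrBr normrM ger0_norm// (le_trans ler01).
  apply: (@le_trans _ _ (D - 1)).
    by have : 2 <= D by [rewrite /D ler_nat]; lra.
  move: tj tj' => /andP[]; rewrite -/w -!natr1 => a1 a2 /andP[a3 a4].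
  rewrite /D /d; have [jj'|/ltnW jj'] := leqP j j'.
    have -> : (j - j' + (j' - j) = j' - j)%N by move: jj'; clear; lia.
    rewrite natrB// distrC ler_normr; apply/orP; left; lra.
  have -> : (j - j' + (j' - j) = j - j')%N by move: jj'; clear; lia.
  rewrite natrB// ler_normr; apply/orP; left; lra.
have e_gt0 : 0 < `|t - t'| by nra.
have tt' : t != t' by rewrite -subr_eq0 -normr_gt0.
have := common_cells_le_angle t01 t01' tt' s_uniq s_l s_l'.
set e := `|t - t'| in tt'w e_gt0 *; set z := (size s)%:R => sz.
have eD : (1 + D) / e <= 3 * w by rewrite ler_pdivrMr//; lra.
have zD : z * (1 + D) <= 8 * ((1 + D) / e) + 2 * (1 + D).
  have := ler_wpM2r (ltW D_gt0) sz; congr (_ <= _); ring.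
have : w <= L * w by rewrite ler_peMl// (le_trans ler01).
by rewrite -mulrA; lra.
Qed.
End Cells.

(** * Slopes whose segments meet many cells *)

Section Slopes.
Context {R : realType}.
Implicit Types (k : nat) (a b t L : R) (p q : R * R) (c : int * int).

(** The discrete L2 estimate: #|P| segments with slopes in distinct dyadic intervals,
    each meeting at least M cells of Q, need about #|P| * M ^+ 2 / (2 ^+ k * k) cells. *)
Lemma hit_slopes_le k (Q : seq (int * int)) L (M : R) (P : {set 'I_(2 ^ k)}) :
    uniq Q -> 1 <= L -> 0 <= M ->
    (forall j, j \in P -> exists2 t, j%:R <= 2 ^+ k * t <= j.+1%:R &
      exists a b, M <= (count (meets_cell k (slanted_segment a b t L)) Q)%:R) ->
  #|P|%:R * M ^+ 2 <= 52 * L * 2 ^+ k * (k.+1)%:R * (size Q)%:R.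
Proof.
move=> Q_uniq L1 M0 hitP; set w : R := 2 ^+ k.
have w_gt0 : 0 < w by exact: exprn_gt0.
pose good (j : 'I_(2 ^ k)) (x : R * R * R) := j%:R <= w * x.2 <= j.+1%:R /\
  M <= (count (meets_cell k (slanted_segment x.1.1 x.1.2 x.2 L)) Q)%:R.
pose f j := xget (0, 0, 0) (good j).
have fP j : j \in P -> good j (f j).
  by move=> /hitP[t tj [a [b abt]]]; apply: xgetPex; exists (a, b, t).
have f01 j : j \in P -> 0 <= (f j).2 <= 1.
  move=> /fP[/andP[l u] _]; apply/andP; split.
    by rewrite -(pmulr_rge0 _ w_gt0); apply: le_trans l.
  rewrite -(ler_pM2l w_gt0) mulr1 (le_trans u)// /w -natrX ler_nat.
  exact: ltn_ord.
pose inc j := meets_cell k (slanted_segment (f j).1.1 (f j).1.2 (f j).2 L).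
pose B (i j : 'I_(2 ^ k)) : R :=
  26 * L * w * ((1 + ((i - j) + (j - i)))%N%:R)^-1.
have L0 : 0 <= L by exact: le_trans L1.
have incM i : i \in P -> M <= (count (inc i) Q)%:R by case/fP.
have incB i j : i \in P -> j \in P ->
    (count (fun c => inc i c && inc j c) Q)%:R <= B i j.
  move=> iP jP.
  rewrite -size_filter /B.
  apply: (common_cells_le (ltn_ord i) (ltn_ord j) L1 (f01 i iP) (f01 j jP)).
  - by have [] := fP i iP.
  - by have [] := fP j jP.
  - exact: filter_uniq.
  - by move=> c; rewrite mem_filter => /andP[/andP[+ _] _]; apply.
  - by move=> c; rewrite mem_filter => /andP[/andP[_ +] _]; apply.
have := incidence_sqr_le M0 incM incB.
have sumB : \sum_(i in P) \sum_(j in P) B i j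
    <= #|P|%:R * (26 * L * w * (2 * (k.+1)%:R)).
  rewrite mulr_natl -sumr_const; apply: ler_sum => i _.
  rewrite -mulr_sumr ler_wpM2l ?mulr_ge0// ?(ltW w_gt0)//.
  apply: le_trans (sum_inv_dist_le R (ltn_ord i)).
  by rewrite [leRHS](bigID (mem P))/= lerDl sumr_ge0// => j _; rewrite invr_ge0.
move=> /le_trans/(_ (ler_wpM2l _ sumB)) => /(_ (ler0n _ _)).
have [->|cardP_gt0] := posnP #|P|.
  by move=> _; rewrite mul0r !mulr_ge0// ltW.
have P_gt0 : 0 < #|P|%:R :> R by rewrite ltr0n.
rewrite exprMn expr2 -mulrA [leRHS]mulrCA ler_pM2l// => /le_trans; apply.
by rewrite le_eqVlt; apply/orP; left; apply/eqP; ring.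
Qed.

Lemma dyadic_cover k (D : set R) : D `<=` `[0, 1[ ->
  exists (P : {set 'I_(2 ^ k)}) (U : set R), [/\
    forall j, j \in P -> exists2 t, D t & j%:R <= 2 ^+ k * t <= j.+1%:R,
    measurable U, D `<=` U
    & (lebesgue_measure U <= (#|P|%:R / 2 ^+ k)%:E)%E].
Proof.
move=> D01; set w : R := 2 ^+ k; have w_gt0 : 0 < w by exact: exprn_gt0.
pose hit (j : nat) t := D t /\ j%:R <= w * t <= j.+1%:R.
pose P := [set j : 'I_(2 ^ k) | `[< exists t, hit j t >]]%SET.
pose I (j : nat) : set R := [set` `[j%:R / w, j.+1%:R / w]].
exists P, (\big[setU/set0]_(j in P) I j); split.
- by move=> j; rewrite inE => /asboolP[t [Dt tj]]; exists t.
- by apply: bigsetU_measurable => j _; exact: measurable_itv.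
- move=> t Dt; have := D01 t Dt; rewrite /= in_itv/= => /andP[t0 t1].
  have wt0 : 0 <= w * t by rewrite mulr_ge0// ltW.
  have /andP[tl tu] := truncn_itv wt0.
  have jk : (Num.truncn (w * t)%R < 2 ^ k)%N.
    rewrite -(ltr_nat R) natrX (le_lt_trans tl)//.
    by rewrite -[ltRHS]mulr1 ltr_pM2l.
  rewrite -bigcup_pred; exists (Ordinal jk) => /=.
    by rewrite inE; apply/asboolP; exists t; split => //; rewrite tl ltW.
  rewrite /I /= in_itv/= ler_pdivrMr// ler_pdivlMr// (mulrC t) tl.
  exact: ltW.
- rewrite -sumr_const mulr_suml.
  pose K (U : set R) (x : R) := measurable U /\ (lebesgue_measure U <= x%:E)%E.
  suff: K (\big[setU/set0]_(j in P) I j) (\sum_(j in P) 1 / w) by case.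
  apply: (big_ind2 K).
  + by split; [exact: measurable0|rewrite measure0].
  + move=> U x V y [mU Ux] [mV Vy]; split; first exact: measurableU.
    by rewrite EFinD (le_trans _ (leeD Ux Vy))//; exact: measureU2.
  + move=> j _; split; first exact: measurable_itv.
    rewrite /I lebesgue_measure_itv/=; case: ifP => _; rewrite -?EFinB lee_fin.
      by rewrite -mulrBl -natr1 addrAC subrr add0r.
    by rewrite mul1r invr_ge0 ltW.
Qed.

Lemma often_meeting_slopes_cover k (Q : seq (int * int)) L (M : R) :
    uniq Q -> 1 <= L -> 0 < M ->
  exists U : set R, [/\ measurable U,
    [set t | 0 <= t < 1 /\ exists a b,
       M <= (count (meets_cell k (slanted_segment a b t L)) Q)%:R] `<=` U
    & (lebesgue_measure U <= (52 * L * (k.+1)%:R * (size Q)%:R / M ^+ 2)%:E)%E].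
Proof.
move=> Q_uniq L1 M_gt0; set D := [set t | _].
have D01 : D `<=` `[0, 1[ by move=> t [t01 _]; rewrite /= in_itv.
have [P [U [hitP mU DU PU]]] := dyadic_cover k D01.
exists U; split => //; apply: (le_trans PU); rewrite lee_fin.
have w_gt0 : 0 < 2 ^+ k :> R by exact: exprn_gt0.
rewrite ler_pdivrMr// mulrAC ler_pdivlMr ?exprn_gt0//.
apply: (le_trans (hit_slopes_le Q_uniq L1 (ltW M_gt0) _)) => [j|].
  by move=> /hitP[t [_ abt] tj]; exists t.
by rewrite le_eqVlt; apply/orP; left; apply/eqP; ring.
Qed.

(** Two steps in each direction, because the sets of level k have diameter below
    2 * 2 ^- k. *)
Definition offsets : seq int := [:: -2; -1; 0; 1; 2].

Definition nearby_cells c : seq (int * int) :=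
  [seq (c.1 + x, c.2 + y) | x <- offsets, y <- offsets].

Lemma floor_near (x y : R) : `|x - y| < 2 ->
  Num.floor y - Num.floor x \in offsets.
Proof.
have /andP[] := floor_itv x; have /andP[] := floor_itv y.
set m := Num.floor y; set n := Num.floor x.
rewrite !intrD ltr_norml => m1 m2 n1 n2 /andP[xy yx].
have mn : m - n < 3 by rewrite -(ltr_int R) intrB; lra.
have nm : -3 < m - n by rewrite -(ltr_int R) intrB; lra.
by move: mn nm; clearbody m n; rewrite /offsets !inE; clear; lia.
Qed.

Lemma cell_nearby k p q :
    `|p.1 - q.1| < 2 * 2 ^- k -> `|p.2 - q.2| < 2 * 2 ^- k ->
  cell k q \in nearby_cells (cell k p).
Proof.
have w_gt0 : 0 < 2 ^+ k :> R by exact: exprn_gt0.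
have near (x y : R) : `|x - y| < 2 * 2 ^- k ->
    Num.floor (2 ^+ k * y) - Num.floor (2 ^+ k * x) \in offsets.
  move=> xy; apply: floor_near; rewrite -mulrBr normrM ger0_norm ?ltW//.
  by rewrite mulrC -ltr_pdivlMr.
move=> /near n1 /near n2; apply/allpairsP; rewrite /cell /=.
exists ((cell k q).1 - (cell k p).1, (cell k q).2 - (cell k p).2).
split; rewrite // /cell /= (addrC (Num.floor (2 ^+ k * p.1))).
by rewrite (addrC (Num.floor (2 ^+ k * p.2))) !subrK.
Qed.

Lemma same_cell_le k p q : cell k p = cell k q ->
  `|p.1 - q.1| <= 2 ^- k /\ `|p.2 - q.2| <= 2 ^- k.
Proof.
have w_gt0 : 0 < 2 ^+ k :> R by exact: exprn_gt0.
have near (x y : R) : Num.floor (2 ^+ k * x) = Num.floor (2 ^+ k * y) ->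
    `|x - y| <= 2 ^- k.
  move=> xy; rewrite -[leRHS]mul1r ler_pdivlMr//.
  have -> : `|x - y| * 2 ^+ k = `|2 ^+ k * x - 2 ^+ k * y|.
    by rewrite -mulrBr normrM (ger0_norm (ltW w_gt0)) mulrC.
  have /andP[] := floor_itv (2 ^+ k * x); have /andP[] := floor_itv (2 ^+ k * y).
  by rewrite xy !intrD ler_norml => *; apply/andP; split; lra.
by case=> /near ? /near ?.
Qed.

End Slopes.
(** * Diameters, Hausdorff content and null sets *)

Section Hausdorff.
Context {R : realType}.
Implicit Types (f : R -> R) (A B : set (R * R)) (p q : R * R) (d : R).

Lemma enorm2_le_sum p : enorm2 p <= `|p.1| + `|p.2|.
Proof.
rewrite -[leRHS]ger0_norm ?addr_ge0// -sqrtr_sqr /enorm2 ler_wsqrtr//.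
rewrite sqrrD !real_normK ?num_real// -addrA lerD2l lerDr.
by rewrite mulrn_wge0// mulr_ge0.
Qed.

Lemma coord_le_enorm2 p : `|p.1| <= enorm2 p /\ `|p.2| <= enorm2 p.
Proof.
by split; rewrite -sqrtr_sqr /enorm2 ler_wsqrtr// ?lerDl ?lerDr sqr_ge0.
Qed.

Lemma ediam_ge0 A : (0 <= ediam A)%E.
Proof. by rewrite /ediam le_max lexx. Qed.

Lemma ediam_le A d : 0 <= d ->
  (forall p q, A p -> A q -> enorm2 (p - q) <= d) -> (ediam A <= d%:E)%E.
Proof.
move=> d0 Ad; rewrite /ediam ge_max lee_fin d0 /=.
by apply: ge_ereal_sup => _ [[p q] [/= Ap Aq] <-]; rewrite lee_fin Ad.
Qed.

Lemma le_ediam A p q : A p -> A q -> ((enorm2 (p - q))%:E <= ediam A)%E.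
Proof.
move=> Ap Aq; rewrite /ediam le_max; apply/orP; right.
by apply: ereal_sup_ubound; exists (p, q).
Qed.

Lemma ediam_set0 : ediam (set0 : set (R * R)) = 0%E.
Proof. by apply/eqP; rewrite eq_le ediam_ge0 andbT; apply: ediam_le. Qed.

Lemma ediam_cell k c : (ediam [set p : R * R | cell k p = c] <= (2 * 2 ^- k)%:E)%E.
Proof.
apply: ediam_le => [|p q /= pc qc]; first by rewrite mulr_ge0// invr_ge0 exprn_ge0.
have [x y] := same_cell_le (etrans pc (esym qc)).
by rewrite (le_trans (enorm2_le_sum _))// mulr2n mulrDl mul1r lerD.
Qed.

(** A doubly indexed cover is re-enumerated along a bijection of nat with
    nat * nat. *)
Lemma hausdorff_delta_le_double f d A (G : nat -> nat -> set (R * R)) :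
    (forall x, 0 <= x -> 0 <= f x) ->
    A `<=` \bigcup_m \bigcup_n G m n ->
    (forall m n, (ediam (G m n) < d%:E)%E) ->
  (hausdorff_delta f d A
    <= \sum_(0 <= m <oo) \sum_(0 <= n <oo) (f (fine (ediam (G m n))))%:E)%E.
Proof.
move=> f0 AG Gd; pose u m n : \bar R := (f (fine (ediam (G m n))))%:E.
have u0 m n : (0 <= u m n)%E by rewrite lee_fin f0// fine_ge0// ediam_ge0.
have /card_set_bijP[g gbij] : ([set: nat] #= [set: nat * nat])%card.
  by rewrite card_eq_sym; exact: card_nat2.
apply: ge_ereal_inf; exists (\sum_(0 <= i <oo) u (g i).1 (g i).2)%E.
  exists (fun i => G (g i).1 (g i).2) => //; split => // p /AG[m _ [n _ Gp]].
  have [i _ gi] := set_bij_surj gbij (I : [set: nat * nat] (m, n)).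
  by exists i; rewrite // gi.
rewrite le_eqVlt; apply/orP; left; apply/eqP.
rewrite nneseries_esumT => [|n]; last exact: u0.
rewrite -(reindex_esum _ _ _ (fun mn => u mn.1 mn.2) gbij).
rewrite (eq_eseriesr (g := fun m => \esum_(n in [set: nat]) u m n)%E); last first.
  by move=> m _; rewrite nneseries_esumT// => n; exact: u0.
rewrite nneseries_esumT; last by move=> m; apply: esum_ge0 => n _; exact: u0.
by rewrite esum_esum//; congr esum; apply/seteqP; split.
Qed.

Lemma hausdorff_deltaS f d A B : A `<=` B ->
  (hausdorff_delta f d A <= hausdorff_delta f d B)%E.
Proof.
move=> AB; apply: ereal_inf_le_tmp => _ [F [BF Fd] <-].
by exists F => //; split => //; exact: subset_trans BF.
Qed.

Lemma hausdorff_delta_anti f d d' A : d' <= d ->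
  (hausdorff_delta f d A <= hausdorff_delta f d' A)%E.
Proof.
move=> dd'; apply: ereal_inf_le_tmp => _ [F [AF Fd] <-].
exists F => //; split => // i; exact: lt_le_trans (Fd i) _.
Qed.

Lemma ex_dyadic_level d : 0 < d < 1 -> exists k, 2 ^- k <= d < 2 * 2 ^- k.
Proof.
move=> /andP[d0 d1].
have ex : exists k, 2 ^- k <= d.
  have [k _ /(_ k (leqnn k)) /= kd] := near_infty_natSinv_expn_lt (PosNum d0).
  by exists k; rewrite -div1r ltW.
case: (ex_minnP ex) => -[|k] kd kmin; first by move: kd; rewrite expr0 invr1; lra.
exists k.+1; rewrite kd exprS invfM mulVKf//.
by rewrite ltNge; apply/negP => /kmin; rewrite ltnn.
Qed.

Lemma negligible_small_covers (A : set R) :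
    (forall e, 0 < e -> exists U : set R, [/\ measurable U, A `<=` U
      & (lebesgue_measure U <= e%:E)%E]) ->
  lebesgue_measure.-negligible A.
Proof.
move=> smallA.
have /choice[U UP] n : exists U : set R, [/\ measurable U, A `<=` U
    & (lebesgue_measure U <= (n.+1%:R^-1)%:E)%E] by apply: smallA; rewrite invr_gt0.
exists (\bigcap_n U n); split.
- by apply: bigcap_measurableType => n _; have [] := UP n.
- apply/eqP; rewrite eq_le measure_ge0 andbT; apply/lee_addgt0Pr => e e0.
  have [n _ /(_ n (leqnn n)) /= ne] := near_infty_natSinv_lt (PosNum e0).
  have [mU _ Ue] := UP n; rewrite add0e (le_trans _ (le_trans Ue _))//.
    apply: le_measure; rewrite ?inE//.
      by apply: bigcap_measurableType => m _; have [] := UP m.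
    by apply: bigcap_inf.
  by rewrite lee_fin ltW.
- by move=> p Ap n _; have [_ AU _] := UP n; exact: AU.
Qed.

End Hausdorff.
(** * From a cover to dyadic cells *)

Section Main.
Context {R : realType}.
Implicit Types (f h : R -> R) (A E : set (R * R)) (F : (set (R * R))^nat).

Lemma summable_eventually_lt (u : nat -> R) (e : R) : (forall i, 0 <= u i) ->
    (\sum_(0 <= i <oo) (u i)%:E < +oo)%E -> 0 < e ->
  exists m, forall i, (m <= i)%N -> u i < e.
Proof.
move=> u0 u_fin e0; have /cvg_series_cvg_0 u_cvg := nnseries_is_cvg u0 u_fin.
have /cvgrPdist_lt/(_ e e0)[m _ um] := u_cvg.
by exists m => i /um; rewrite /= sub0r normrN ger0_norm.
Qed.

Definition cover_diam F i : R := fine (ediam (F i)).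

(** Sets of diameter 0 have no level: h vanishes on them, and they are treated
    apart. *)
Definition dyadic_level (d : nat -> R) (lev : nat -> nat) :=
  forall i, 0 < d i -> 2 ^- lev i <= d i < 2 * 2 ^- lev i.

Definition cells_near_level (d : nat -> R) (lev : nat -> nat)
    (x : nat -> R * R) (Q : nat -> seq (int * int)) :=
  forall k c, c \in Q k <->
    exists i, [/\ 0 < d i, lev i = k & c \in nearby_cells (cell k (x i))].

(** The sets of diameter 0 cost nothing; each remaining point of A lies in a set
    of some level k, hence in a cell of Q k, and that cell meets A.  Doubling is
    what allows a cell of diameter at most 2 * 2 ^- k to be charged to
    f (2 ^- k). *)
Lemma hausdorff_delta_le_cells f (C d : R) A F lev x Q :
    dimension_function f -> (forall y, 0 <= y -> f (2 * y) <= C * f y) ->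
    A `<=` \bigcup_i F i ->
    (forall i, ediam (F i) < (d / 2)%:E)%E -> (forall i p, F i p -> F i (x i)) ->
    dyadic_level (cover_diam F) lev ->
    (forall k, uniq (Q k)) -> cells_near_level (cover_diam F) lev x Q ->
  (hausdorff_delta f d A <=
   \sum_(0 <= k <oo) (C * f (2 ^- k) * (count (meets_cell k A) (Q k))%:R)%:E)%E.
Proof.
move=> [f0 f_homo _ f00] doubling AF Fd Fx levP Q_uniq QP.
have diam_fin i : ediam (F i) \is a fin_num.
  by rewrite ge0_fin_numE ?ediam_ge0//; exact: lt_trans (Fd i) (ltry _).
have diam_ge0 i : 0 <= cover_diam F i by rewrite fine_ge0// ediam_ge0.
have d_gt0 : 0 < d.
  have := le_lt_trans (ediam_ge0 _) (Fd 0%N); rewrite lte_fin => ?.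
  by rewrite -(divfK (_ : (2 : R) != 0) d)// mulr_gt0.
pose hitQ k := [seq c <- Q k | meets_cell k A c].
(* Row 0 of the cover holds the sets of diameter 0, row k.+1 the cells of level
   k that meet A. *)
pose G k n : set (R * R) := if k is k'.+1
  then if (n < size (hitQ k'))%N
       then [set p | cell k' p = nth (0, 0) (hitQ k') n] else set0
  else if cover_diam F n == 0 then F n else set0.
have w_gt0 k : 0 < 2 ^- k :> R by rewrite invr_gt0 exprn_gt0.
have AG : A `<=` \bigcup_k \bigcup_n G k n.
  move=> p Ap; have [i _ Fip] := AF p Ap.
  have [di0|di_neq0] := eqVneq (cover_diam F i) 0.
    by exists 0%N => //; exists i => //=; rewrite di0 eqxx.
  have di_gt0 : 0 < cover_diam F i by rewrite lt_neqAle eq_sym di_neq0 diam_ge0.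
  have /andP[_ di] := levP i di_gt0; set k := lev i in di.
  have pQ : cell k p \in hitQ k.
    rewrite mem_filter; apply/andP; split; first by apply/asboolP; exists p.
    apply/QP; exists i; split => //.
    have := le_ediam (Fx i p Fip) Fip; rewrite -(fineK (diam_fin i)) lee_fin.
    have [/= x1 x2] := coord_le_enorm2 (x i - p) => xp.
    by apply: cell_nearby; apply: le_lt_trans di; apply: le_trans xp.
  exists k.+1 => //; exists (index (cell k p) (hitQ k)) => //=.
  by rewrite index_mem pQ /= nth_index.
have G0 : (ediam (set0 : set (R * R)) < d%:E)%E by rewrite ediam_set0 lte_fin.
have Gd k n : (ediam (G k n) < d%:E)%E.
  case: k => [|k] /=.
    case: ifP => // _; apply: lt_trans (Fd n) _; rewrite lte_fin; lra.
  case: ifP => // nk; apply: le_lt_trans (ediam_cell _ _) _.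
  have : nth (0, 0) (hitQ k) n \in hitQ k by exact: mem_nth.
  rewrite mem_filter => /andP[_ /QP[i [di <- _]]].
  have /andP[+ _] := levP i di; have := Fd i.
  by rewrite -(fineK (diam_fin i)) !lte_fin -/(cover_diam F i) => ? ?; lra.
apply: (le_trans (hausdorff_delta_le_double f0 AG Gd)).
have Gk_ge0 k n : (0 <= (f (fine (ediam (G k n))))%:E)%E.
  by rewrite lee_fin f0// fine_ge0// ediam_ge0.
have term_ge0 k : (0 <= (C * f (2 ^- k) * (count (meets_cell k A) (Q k))%:R)%:E)%E.
  rewrite lee_fin mulr_ge0//; apply: le_trans (doubling _ (ltW (w_gt0 k))).
  by rewrite f0// mulr_ge0// ltW.
rewrite (nneseries_split 0 1) => [|k _]; last exact: nneseries_ge0.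
rewrite big_nat1 add0n [X in (X + _)%E]eseries0 ?add0e => [|n _ _]; last first.
  rewrite /=; case: ifP => [/eqP|_]; first by rewrite /cover_diam => ->; rewrite f00.
  by rewrite ediam_set0 f00.
rewrite -nneseries_addn; last first. by move=> k; exact: nneseries_ge0.
apply: lee_nneseries => [k _ _|k _]; first exact: nneseries_ge0.
rewrite addn1.
rewrite (nneseries_split 0 (size (hitQ k))) => [|n _]; last exact: Gk_ge0.
rewrite [X in (_ + X)%E]eseries0 ?adde0 => [|n kn _]; last first.
  by rewrite /= ltnNge -[(size _ <= _)%N]/(0 + size _ <= n)%N kn/= ediam_set0 f00.
rewrite add0n sumEFin lee_fin -size_filter -/(hitQ k).
rewrite mulr_natr -[X in _ *+ X]subn0 -sumr_const_nat.
apply: ler_sum_nat => n /andP[_ nk]; rewrite /= nk.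
apply: le_trans (doubling _ (ltW (w_gt0 k))); apply: f_homo.
  by rewrite fine_ge0// ediam_ge0.
rewrite -lee_fin fineK; first exact: ediam_cell.
by rewrite ge0_fin_numE ?ediam_ge0// (le_lt_trans (ediam_cell _ _))// ltry.
Qed.

(** Only finitely many sets have level k, because each of them costs at least
    h (2 ^- k) > 0.  Each needs the 25 cells around the cell of one of its
    points. *)
Lemma ex_cells_near_level h F lev x :
    dimension_function h -> (forall y, 0 < y -> 0 < h y) ->
    dyadic_level (cover_diam F) lev ->
    (\sum_(0 <= i <oo) (h (cover_diam F i))%:E < +oo)%E ->
  exists Q, cells_near_level (cover_diam F) lev x Q /\ forall k,
    uniq (Q k) /\ (((size (Q k))%:R * h (2 ^- k))%:E <= 25%:E *
      \sum_(0 <= i <oo)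
        (if (0 < cover_diam F i) && (lev i == k) then h (cover_diam F i) else 0)%:E)%E.
Proof.
move=> [h0 h_homo _ _] h_gt0 levP h_fin; set d := cover_diam F.
have w_gt0 k : 0 < 2 ^- k :> R by rewrite invr_gt0 exprn_gt0.
have d_ge0 i : 0 <= d i by rewrite fine_ge0// ediam_ge0.
have /choice[m mP] k : exists m, forall i, (m <= i)%N -> h (d i) < h (2 ^- k).
  apply: (@summable_eventually_lt (fun i => h (d i))) => //; last exact: h_gt0.
  by move=> i; exact: h0.
pose at_level k i := (0 < d i) && (lev i == k).
pose J k := [seq i <- iota 0 (m k) | at_level k i].
have JP k i : (i \in J k) = at_level k i.
  rewrite mem_filter mem_iota add0n /=; case lki : (at_level k i) => //=.
  move: lki => /andP[/levP/andP[wd _] /eqP lik]; rewrite ltnNge; apply/negP => /mP.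
  by rewrite ltNge h_homo// -?lik// ltW.
pose Q k := undup (flatten [seq nearby_cells (cell k (x i)) | i <- J k]).
exists Q; split=> [k c|k].
  rewrite mem_undup; split=> [/flatten_mapP[i]|[i [di lik ci]]].
    by rewrite JP => /andP[di /eqP lik] ci; exists i.
  by apply/flatten_mapP; exists i; rewrite // JP /at_level di lik eqxx.
split; first exact: undup_uniq.
have sizeQ : (size (Q k))%:R <= 25 * (size (J k))%:R :> R.
  rewrite -natrM ler_nat (leq_trans (size_undup _))// size_flatten /shape -map_comp.
  rewrite (eq_map (g := fun=> 25%N)) => [|i //].
  by rewrite sumnE big_map big_const_seq count_predT iter_addn_0.
apply: (@le_trans _ _ (25 * \sum_(i <- J k) h (d i))%:E).
  rewrite lee_fin; apply: (@le_trans _ _ (25 * (size (J k))%:R * h (2 ^- k))).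
    by rewrite ler_wpM2r// h0// ltW.
  rewrite -mulrA ler_wpM2l// mulr_natl.
  rewrite (_ : _ *+ _ = \sum_(i <- J k) h (2 ^- k)); last first.
    by rewrite big_const_seq count_predT iter_addr_0.
  rewrite big_seq [leRHS]big_seq; apply: ler_sum => i.
  rewrite JP => /andP[/levP/andP[wd _] /eqP lik].
  by rewrite -lik h_homo// ltW.
rewrite EFinM lee_wpmul2l ?lee_fin// big_filter big_mkcond /=.
apply: le_trans (nneseries_lim_ge (m k) _); last first.
  by move=> i _ _; rewrite lee_fin; case: ifP => // _; exact: h0.
by rewrite sumEFin lee_fin /index_iota subn0.
Qed.

(** Each set of the cover has at most one level. *)
Lemma level_sums_le h F lev : dimension_function h ->
  (\sum_(0 <= k <oo) \sum_(0 <= i <oo)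
     (if (0 < cover_diam F i)%R && (lev i == k) then h (cover_diam F i) else 0)%:E
   <= \sum_(0 <= i <oo) (h (cover_diam F i))%:E)%E.
Proof.
move=> [h0 _ _ _]; set d := cover_diam F.
have d_ge0 i : 0 <= d i by rewrite fine_ge0// ediam_ge0.
have u0 k i : (0 <= (if (0 < d i)%R && (lev i == k) then h (d i) else 0)%:E :> \bar R)%E.
  by rewrite lee_fin; case: ifP => // _; exact: h0.
rewrite nneseries_interchange//; apply: lee_nneseries => [i _ _|i _].
  exact: nneseries_ge0.
rewrite (nneseries_split 0 (lev i).+1) => [|k _]; last exact: u0.
rewrite [X in (_ + X)%E]eseries0 ?adde0 => [|k lik _]; last first.
  by rewrite (_ : _ == _ = false) ?andbF//; apply/negbTE; lia.
rewrite add0n big_nat_recr//= big_nat big1 ?add0e => [|k /andP[_ ki]]; last first.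
  by rewrite (_ : _ == _ = false) ?andbF//; apply/negbTE; lia.
by rewrite lee_fin; case: ifP => // _; exact: h0.
Qed.

End Main.
(** * Rich slopes form a null set *)

Section RichSlopes.
Context {R : realType}.
Implicit Types (f h : R -> R) (E : set (R * R)).

(** Length of the segment, scale of the content and lower bound on the content
    are tied to one integer n, so that every slope of a Furstenberg set belongs
    to one of countably many classes that are uniform in all three. *)
Definition rich_slopes f E n : set R :=
  [set t | 0 <= t < 1 /\ exists a b,
    ((n.+1%:R^-1)%:E < hausdorff_delta f n.+1%:R^-1
       (slanted_segment a b t n.+1%:R `&` E))%E].

Lemma furstenberg_rich_slopes f E : furstenberg_set f E ->
  `[0, 1[ `<=` \bigcup_n rich_slopes f E n.
Proof.
move=> furE t; rewrite /= in_itv/= => t01; have /andP[t0 _] := t01.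
set r := Num.sqrt (1 + t ^+ 2).
have r_ge1 : 1 <= r.
  by rewrite -[leLHS]sqrtr1 ler_wsqrtr// lerDl sqr_ge0.
have r_gt0 : 0 < r by exact: lt_le_trans r_ge1.
(* The direction of slope t; division by r >= 1 only shortens projections. *)
have circ : unit_circle (r^-1, t * r^-1).
  rewrite /unit_circle /enorm2 /= -[X in X + _]mul1r exprMn -mulrDl.
  rewrite -[X in X * _]sqr_sqrtr ?addr_ge0 ?sqr_ge0// -/r -exprMn divff ?gt_eqF//.
  by rewrite expr1n sqrtr1.
have [_ [a0 [L [L0 ->]]] /ereal_sup_gt[_ [d /= d0 <-] Hd]] := furE _ circ.
set A := _ `&` E in Hd.
have [u u0 uH] : exists2 u : R, 0 < u & (u%:E < hausdorff_delta f d A)%E.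
  move: Hd; case: (hausdorff_delta _ _ _) => [v|_|//].
    rewrite lte_fin => v0; exists (v / 2); rewrite ?divr_gt0// lte_fin; lra.
  by exists 1 => //; rewrite ltry.
pose y := L + d^-1 + u^-1.
have [dV uV] : 0 < d^-1 /\ 0 < u^-1 by rewrite !invr_gt0.
have y0 : 0 <= y by rewrite !addr_ge0// ltW.
have /andP[_ yn] := truncn_itv y0; set n := Num.truncn y in yn.
have [yL yd yu] : [/\ L <= n.+1%:R, d^-1 <= n.+1%:R & u^-1 <= n.+1%:R].
  by move: yn; rewrite /y; split; lra.
exists n => //; split => //; exists a0.1, (a0.2 - t * a0.1).
have nu : n.+1%:R^-1 <= u by rewrite invf_ple ?posrE.
have nd : n.+1%:R^-1 <= d by rewrite invf_ple ?posrE.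
apply: (@le_lt_trans _ _ u%:E); first by rewrite lee_fin.
apply: (lt_le_trans uH); apply: le_trans (hausdorff_delta_anti _ _ nd) _.
apply: hausdorff_deltaS => _ [[s /= + <-] Ep].
rewrite in_itv/= => /andP[s0 sL]; split => //; split; last first.
  rewrite -[LHS]/(a0.2 + s * (t * r^-1)) -[RHS]/(a0.2 - t * a0.1 + t * (a0.1 + s * r^-1)).
  ring.
rewrite -[X in _ <= X <= _]/(a0.1 + s * r^-1).
have sr : 0 <= s * r^-1 by rewrite mulr_ge0// invr_ge0 ltW.
rewrite lerDl sr lerD2l (le_trans _ yL)// (le_trans _ sL)//.
by rewrite ler_pdivrMr// ler_peMr.
Qed.

(** A rich slope has a segment meeting at least c * s k cells of level k for some
    k >= 1, and the slopes with this property at level k have measure at most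
    K times the cost of the cells of that level. *)
Lemma rich_slopes_negligible f h E n :
    doubling_dimension_function f -> dimension_function h ->
    (forall x, 0 < x -> 0 < h x) ->
    (\sum_(0 <= k <oo) (f (2 ^- k) * Num.sqrt (k%:R / h (2 ^- k)))%:E < +oo)%E ->
    (hausdorff h E <= 0)%E ->
  lebesgue_measure.-negligible (rich_slopes f E n).
Proof.
move=> [f_dim [C C0 doubling]] h_dim h_gt0 fs_fin HE.
have [f0 _ _ _] := f_dim; have [h0 _ _ _] := h_dim.
have w_gt0 k : 0 < 2 ^- k :> R by rewrite invr_gt0 exprn_gt0.
pose s k := Num.sqrt (k%:R / h (2 ^- k)).
have fs_ge0 k : (0 <= (f (2 ^- k) * s k)%:E)%E.
  by rewrite lee_fin mulr_ge0 ?sqrtr_ge0// f0// ltW.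
pose S := fine (\sum_(0 <= k <oo) (f (2 ^- k) * s k)%:E)%E.
have SE : (\sum_(0 <= k <oo) (f (2 ^- k) * s k)%:E)%E = S%:E.
  by rewrite fineK// ge0_fin_numE// nneseries_ge0.
have S_ge0 : 0 <= S by rewrite fine_ge0// nneseries_ge0.
pose L : R := n.+1%:R; have L_ge1 : 1 <= L by rewrite ler1n.
have L_gt0 : 0 < L by exact: lt_le_trans L_ge1.
(* With this c, covering by fewer than c * s k cells at each level k gives
   content at most L^-1, the threshold of the class. *)
pose c := (L * (C * S + 1))^-1.
have CS_gt0 : 0 < C * S + 1 by rewrite ltr_wpDl// mulr_ge0// ltW.
have c_gt0 : 0 < c by rewrite invr_gt0 mulr_gt0.
have cS : c * (C * S) <= L^-1.
  rewrite /c invfM -mulrA ler_piMr ?invr_ge0 ?(ltW L_gt0)//.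
  by rewrite ler_pdivrMl// mulr1 lerDl.
(* 52 comes from the counting of slopes, the factor 2 from k.+1 <= 2 * k. *)
pose K := 104 * L / c ^+ 2.
have K_gt0 : 0 < K by rewrite divr_gt0 ?mulr_gt0// exprn_gt0.
apply: negligible_small_covers => e e0.
(* Half the scale L^-1 of the content, since a set of diameter d_i is replaced by
   cells whose diameters may reach 2 * d_i. *)
pose d := L^-1 / 2; have d_gt0 : 0 < d by rewrite divr_gt0// invr_gt0.
have d_lt1 : d < 1.
  have : L^-1 <= 1 by rewrite invf_le1.
  by rewrite /d; move: (L^-1) => y y1; lra.
pose eta := e / (25 * K); have eta_gt0 : 0 < eta by rewrite divr_gt0// mulr_gt0.
have [_ [F [EF Fd] <-] Feta] : exists2 v, [set (\sum_(0 <= i <oo)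
      (h (fine (ediam (F i))))%:E)%E | F in [set F : (set (R * R))^nat |
      E `<=` \bigcup_i F i /\ forall i, (ediam (F i) < d%:E)%E]] v
    & (v < eta%:E)%E.
  apply: ereal_inf_lt; apply: (@le_lt_trans _ _ 0%E); last by rewrite lte_fin.
  by apply: le_trans HE; apply: ereal_sup_ubound; exists d.
have diam_lt1 i : cover_diam F i < 1.
  apply: lt_trans d_lt1; rewrite -lte_fin fineK//.
  by rewrite ge0_fin_numE ?ediam_ge0// (lt_trans (Fd i))// ltry.
have /choice[lev levP] i : exists k, 0 < cover_diam F i ->
    2 ^- k <= cover_diam F i < 2 * 2 ^- k.
  have [d0|d0] := ltP 0 (cover_diam F i); last by exists 0%N.
  have [|k kP] := @ex_dyadic_level _ (cover_diam F i); first by rewrite d0 diam_lt1.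
  by exists k.
have /choice[x xP] i : exists x, forall p, F i p -> F i x.
  have [[p Fp]|nF] := pselect (exists p, F i p); first by exists p.
  by exists (0, 0) => p Fp; case: nF; exists p.
have [Q [QP Qk]] := ex_cells_near_level x h_dim h_gt0 levP (lt_trans Feta (ltry _)).
(* All diameters are below 1, so no set has level 0, where s 0 = 0 would make
   every slope qualify. *)
have Q0 : Q 0%N = [::].
  case: (Q 0%N) (QP 0%N) => // q Q' /(_ q)[+ _]; rewrite mem_head => -[//|i [di li _]].
  by have := levP i di; rewrite li expr0 invr1 leNgt diam_lt1.
have /choice[U UP] k : exists U : set R, [/\ measurable U,
    (0 < k)%N -> [set t | 0 <= t < 1 /\ exists a b,
      c * s k <= (count (meets_cell k (slanted_segment a b t L)) (Q k))%:R] `<=` U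
    & (lebesgue_measure U <= K%:E * ((size (Q k))%:R * h (2 ^- k))%:E)%E].
  have [->|k_gt0] := posnP k.
    exists set0; split => //; rewrite measure0 -EFinM lee_fin.
    by apply: mulr_ge0; [exact: ltW|apply: mulr_ge0 => //; apply: h0; exact: ltW].
  have hk := h_gt0 _ (w_gt0 k).
  have kR : 0 < k%:R :> R by rewrite ltr0n.
  have s_gt0 : 0 < s k by rewrite sqrtr_gt0 divr_gt0.
  have [U [mU DU lU]] := often_meeting_slopes_cover k (Qk k).1 L_ge1 (mulr_gt0 c_gt0 s_gt0).
  exists U; split => //; apply: (le_trans lU); rewrite -EFinM lee_fin.
  rewrite exprMn (sqr_sqrtr (divr_ge0 (ltW kR) (ltW hk))).
  have -> : 52 * L * k.+1%:R * (size (Q k))%:R / (c ^+ 2 * (k%:R / h (2 ^- k)))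
      = (k.+1%:R / (2 * k%:R)) * (K * ((size (Q k))%:R * h (2 ^- k))).
    by rewrite /K; field; rewrite !gt_eqF.
  rewrite ler_piMl//.
    by apply: mulr_ge0; [exact: ltW|apply: mulr_ge0 => //; exact: ltW].
  rewrite ler_pdivrMr ?mulr_gt0// mul1r -natrM ler_nat; move: k_gt0; clear; lia.
exists (\bigcup_k U k); split.
- by apply: bigcup_measurable => k _; have [] := UP k.
- move=> t [t01 [a [b rich]]].
  have [[k [k0 kt]]|poor] := pselect (exists k, (0 < k)%N /\
      c * s k <= (count (meets_cell k (slanted_segment a b t L)) (Q k))%:R).
    by exists k => //; have [_ /(_ k0) + _] := UP k; apply; split=> //; exists a, b.
  exfalso; move: rich; apply/negP; rewrite -leNgt -/L.
  set A := slanted_segment _ _ _ _ `&` E.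
  have AF : A `<=` \bigcup_i F i by move=> p [_ /EF].
  apply: le_trans (hausdorff_delta_le_cells f_dim doubling AF Fd xP levP
    (fun k => (Qk k).1) QP) _.
  apply: (@le_trans _ _ (\sum_(0 <= k <oo) (C * c)%:E * (f (2 ^- k) * s k)%:E)%E).
    apply: lee_nneseries => [k _ _|k _]; rewrite lee_fin.
      by rewrite !mulr_ge0// ?(ltW C0)// f0// ltW.
    rewrite -!mulrA ler_pM2l// mulrCA ler_wpM2l ?f0// ?(ltW (w_gt0 _))//.
    have [->|k0] := posnP k.
      by rewrite Q0 /= mulr_ge0 ?sqrtr_ge0// ltW.
    rewrite leNgt; apply/negP => sk; apply: poor; exists k; split => //.
    apply: (le_trans (ltW sk)); rewrite ler_nat; apply: sub_count => q.
    by move=> /asboolP[p [lp _] pq]; apply/asboolP; exists p.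
  by rewrite nneseriesZl// SE lee_fin -mulrA mulrCA.
- have mU k : measurable (U k) by have [] := UP k.
  have := @measure_sigma_subadditive _ _ _ (@lebesgue_measure R) (\bigcup_k U k) U.
  move=> /(_ mU (bigcup_measurable (fun k _ => mU k))) /(_ (fun t Ut => Ut)).
  move=> /le_trans; apply.
  have K25_gt0 : 0 < K * 25 by rewrite mulr_gt0.
  have -> : e%:E = ((K * 25)%:E * eta%:E)%E.
    by rewrite -EFinM /eta; congr EFin; field; rewrite gt_eqF.
  apply: (@le_trans _ _ ((K * 25)%:E * \sum_(0 <= i <oo) (h (cover_diam F i))%:E)%E); last first.
    by rewrite lee_wpmul2l ?lee_fin ?(ltW K25_gt0)// ltW.
  apply: (@le_trans _ _ ((K * 25)%:E * \sum_(0 <= k <oo) \sum_(0 <= i <oo)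
     (if (0 < cover_diam F i)%R && (lev i == k) then h (cover_diam F i) else 0)%:E)%E); last first.
    by rewrite lee_wpmul2l ?lee_fin ?(ltW K25_gt0)// level_sums_le.
  have u0 k i : (0 <= (if (0 < cover_diam F i)%R && (lev i == k)
      then h (cover_diam F i) else 0)%:E :> \bar R)%E.
    by rewrite lee_fin; case: ifP => // /andP[di _]; rewrite h0// ltW.
  rewrite -nneseriesZl => [|k _]; last exact: nneseries_ge0.
  apply: lee_nneseries => [k _ _|k _]; first exact: measure_ge0.
  have [_ _ /le_trans] := UP k; apply; rewrite [(K * 25)%:E]EFinM -muleA.
  by rewrite lee_wpmul2l ?lee_fin ?(ltW K_gt0)//; exact: (Qk k).2.
Qed.

End RichSlopes.

Theorem theorem3p1 (R : realType) (hh : R -> R) (E : set (R * R)) (h : R -> R)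
  (hh_doubling : doubling_dimension_function hh)
  (E_furstenberg : furstenberg_set hh E)
  (h_dim : dimension_function h)
  (h_prec : dim_prec h (fun x => hh x ^+ 2))
  (h_sum : (\sum_(0 <= k <oo)
     (hh (2 ^- k) * Num.sqrt (k%:R / h (2 ^- k)))%:E < +oo)%E) :
  (0 < hausdorff h E)%E.
Proof.
rewrite ltNge; apply/negP => HE0.
have [N [mN N0 richN]] : lebesgue_measure.-negligible (\bigcup_n rich_slopes hh E n).
  by apply: negligible_bigcup => n; apply: rich_slopes_negligible HE0 => //; case: h_prec.
have subN : `[0, 1[ `<=` N by apply: subset_trans richN; exact: furstenberg_rich_slopes.
have : (lebesgue_measure [set` `[0%R, 1%R : R[%R] <= lebesgue_measure N)%E.
  by apply: le_measure; rewrite ?inE//; exact: measurable_itv.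
by rewrite N0 lebesgue_measure_itv/= lte_fin ltr01 -EFinB subr0 lee_fin ler10.
Qed.
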